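(* Let $g \in L^2(\mathbb{R}^d,\mathbb{R})$ be a real-valued window function and suppose that $\mathcal{L} \subseteq \mathbb{R}^{2d}$ satisfies one of the following two conditions: (1) $\mathcal{L} = \Lambda \times \mathbb{R}^d$ with $\Lambda$ a lattice in $\mathbb{R}^d$; (2) $\mathcal{L}$ is a separable lattice, i.e. $\mathcal{L}=\mathcal{A}\times\mathcal{B}$ with $\mathcal{A},\mathcal{B}$ lattices in $\mathbb{R}^d$. Then there exist two real-valued functions $f_1,f_2 \in L^2(\mathbb{R}^d,\mathbb{R})$ such that $|V_g f_1(z)| = |V_g f_2(z)|$ for all $z \in \mathcal{L}$ and $f_1\neq f_2$, $f_1\neq -f_2$ (equivalently, there is no $\nu\in\mathbb{C}$ with $|\nu|=1$ and $f_1=\nu f_2$).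
   Context: $V_gf(x,\omega)=\int_{\mathbb{R}^d} f(t)\overline{g(t-x)}e^{-2\pi i \omega\cdot t}\,dt$ is the short-time Fourier transform. A lattice in $\mathbb{R}^d$ is $A\mathbb{Z}^d$ with $A\in\mathrm{GL}_d(\mathbb{R})$. $L^2(\mathbb{R}^d,\mathbb{R})$ denotes the real-valued functions in $L^2(\mathbb{R}^d)$. *)

(* Defs.v *)
From HB Require Import structures.
From mathcomp Require Import all_boot all_order all_algebra.
From mathcomp Require Import all_classical all_reals all_analysis.
Set Implicit Arguments. Unset Strict Implicit. Unset Printing Implicit Defensive.
Import Order.TTheory GRing.Theory Num.Theory.
Import numFieldNormedType.Exports.
Local Open Scope classical_set_scope.
Local Open Scope ring_scope.

(* Points of R^d are d-tuples of reals, with the library's product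
   sigma-algebra on d.-tuple R (generated by the coordinate maps). *)

(* Lebesgue integral over R^d of a nonnegative (extended-real valued)
   function, computed as the iterated integral (Tonelli) with respect to the
   one-dimensional Lebesgue measure. For nonnegative measurable functions this
   is the d-dimensional Lebesgue integral. *)
Fixpoint iint {R : realType} (n : nat) : (n.-tuple R -> \bar R) -> \bar R :=
  match n return (n.-tuple R -> \bar R) -> \bar R with
  | 0 => fun F => F [tuple]
  | m.+1 => fun F =>
      (\int[@lebesgue_measure R]_(x in [set: R]) iint (fun t : m.-tuple R => F (cons_tuple x t)))%E
  end.

Definition rint {R : realType} (d : nat) (F : d.-tuple R -> R) : R :=
  fine (iint (fun t => (Num.max (F t) 0)%:E) - iint (fun t => (Num.max (- F t) 0)%:E))%E.

(* f is (a Borel representative of) an element of L^2(R^d, R) *)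
Definition L2R {R : realType} (d : nat) (f : d.-tuple R -> R) : Prop :=
  measurable_fun [set: d.-tuple R] f /\
  (iint (fun t => ((f t) ^+ 2)%:E) < +oo)%E.

Definition L2eq {R : realType} (d : nat) (f1 f2 : d.-tuple R -> R) : Prop :=
  iint (fun t => ((f1 t - f2 t) ^+ 2)%:E) = 0%E.

Definition tsub {R : realType} (d : nat) (t x : d.-tuple R) : d.-tuple R :=
  [tuple tnth t i - tnth x i | i < d].

Definition tdot {R : realType} (d : nat) (w t : d.-tuple R) : R :=
  \sum_(i < d) tnth w i * tnth t i.

(* Short-time Fourier transform of real f with real window g:
   V_g f(x,w) = int f(t) g(t-x) e^{-2 pi i w.t} dt
             = int f g(.-x) cos(2 pi w.t) dt - i int f g(.-x) sin(2 pi w.t) dt.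
   STFT_re, STFT_im are its real and imaginary parts; STFT_abs its modulus. *)
Definition STFT_re {R : realType} (d : nat) (g f : d.-tuple R -> R)
  (x w : d.-tuple R) : R :=
  rint (fun t => f t * g (tsub t x) * cos (2 * pi * tdot w t)).

Definition STFT_im {R : realType} (d : nat) (g f : d.-tuple R -> R)
  (x w : d.-tuple R) : R :=
  - rint (fun t => f t * g (tsub t x) * sin (2 * pi * tdot w t)).

Definition STFT_abs {R : realType} (d : nat) (g f : d.-tuple R -> R)
  (x w : d.-tuple R) : R :=
  Num.sqrt (STFT_re g f x w ^+ 2 + STFT_im g f x w ^+ 2).

Definition lattice {R : realType} (d : nat) (A : 'M[R]_d) : set (d.-tuple R) :=
  [set x | exists k : 'I_d -> int,
      forall i : 'I_d, tnth x i = \sum_(j < d) A i j * (k j)%:~R].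

(* Main.v *)
(** Both conditions only constrain the time variable to a lattice [Lam], so it
    suffices to treat [Lam * R^d].  Let [p] be bounded and [Lam]-periodic, and put
    [f1 t = g (- t) * p t] and [f2 t = g (- t) * p (- t)].  For [x] in [Lam] the
    substitution [t -> x - t] exchanges [f1 * g (. - x)] and [f2 * g (. - x)],
    hence their Fourier transforms have the same modulus at every frequency.
    With [p t = 1 + frac (w . t)], [w] a nonzero vector of the dual lattice,
    [p t <> p (- t)] unless [2 (w . t)] is an integer, which happens only on
    countably many hyperplanes, and [p t + p (- t) > 0]; so [f1] and [f2] differ
    up to sign as soon as [g] is not null.  If [g] is null, every transform
    vanishes. *)
Require Import Defs.
From HB Require Import structures.
From mathcomp Require Import all_boot all_order all_algebra.
From mathcomp Require Import all_classical all_reals all_analysis.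
From mathcomp Require Import measurable_realfun ring lra.
Set Implicit Arguments. Unset Strict Implicit. Unset Printing Implicit Defensive.
Import Order.TTheory GRing.Theory Num.Theory.
Import numFieldNormedType.Exports.
Local Open Scope classical_set_scope.
Local Open Scope ring_scope.

(** * The iterated integral as integration against a sigma-finite measure *)

Section as_sigma_finite.
Context d (T : measurableType d) (R : realType) (m : {measure set T -> \bar R})
  (m_sf : sigma_finite setT m).

(** The body is just [m]; the proof argument gives a fresh head symbol on which the sigma-finite
    structure can be declared for an arbitrary [m]. *)
Definition as_sigma_finite of sigma_finite setT m : set T -> \bar R := m.

Let mu := as_sigma_finite m_sf.

HB.instance Definition _ := Measure.on mu.

HB.instance Definition _ := Measure_isSigmaFinite.Build _ _ _ mu m_sf.

Lemma ex_sigma_finite_measure :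
  exists mu : {sigma_finite_measure set T -> \bar R}, forall A, mu A = m A.
Proof. by exists mu. Qed.

End as_sigma_finite.

(** The measure is the image of the product measure under [phi], and Tonelli unfolds its integrals.
    The left inverse [psi] serves sigma-finiteness: rectangles exhausting [T1 * T2], pulled back
    along [psi], cover [T3], and pulling them back further along [phi] returns the rectangles, of
    finite measure. *)
Lemma ex_pushforward_prod_measure d1 d2 d3 (T1 : measurableType d1)
    (T2 : measurableType d2) (T3 : measurableType d3) (R : realType)
    (m1 : {sigma_finite_measure set T1 -> \bar R})
    (m2 : {sigma_finite_measure set T2 -> \bar R})
    (phi : T1 * T2 -> T3) (psi : T3 -> T1 * T2) :
    measurable_fun [set: T1 * T2] phi -> measurable_fun [set: T3] psi ->
    cancel phi psi ->
  exists mu : {sigma_finite_measure set T3 -> \bar R},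
    forall F : T3 -> \bar R, measurable_fun [set: T3] F ->
      (forall t, 0 <= F t)%E ->
      (\int[mu]_t F t = \int[m1]_x \int[m2]_y F (phi (x, y)))%E.
Proof.
move=> mphi mpsi phiK.
pose m := pushforward (m1 \x m2)%E phi.
have m_sf : sigma_finite setT m.
  have /sigma_finiteP[F [TF ndF Foo]] := sigma_finiteT m1.
  have /sigma_finiteP[G [TG ndG Goo]] := sigma_finiteT m2.
  exists (fun k => psi @^-1` (F k `*` G k)).
    apply/seteqP; split => // t _.
    have [i _ Fi] : (\bigcup_i F i) (psi t).1 by rewrite -TF.
    have [j _ Gj] : (\bigcup_i G i) (psi t).2 by rewrite -TG.
    exists (maxn i j) => //; split.
    - by move: Fi; exact/subsetPset/ndF/leq_maxl.
    - by move: Gj; exact/subsetPset/ndG/leq_maxr.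
  move=> k; have [mF Fk] := Foo k; have [mG Gk] := Goo k; split.
    by rewrite -[X in measurable X]setTI; apply: mpsi => //; exact: measurableX.
  rewrite /m /pushforward -comp_preimage (_ : psi \o phi = id); last first.
    by apply/funext => x /=; rewrite phiK.
  by rewrite preimage_id product_measure1E// lte_mul_pinfty// ge0_fin_numE.
have [mu muE] := @ex_sigma_finite_measure _ _ _ (pushforward (m1 \x m2)%E phi) m_sf.
exists mu => F mF F0.
have := @ge0_integral_pushforward _ _ _ _ R phi mphi (m1 \x m2)%E setT F
  measurableT mF.
rewrite preimage_setT => H.
transitivity (\int[(m1 \x m2)%E]_z (F \o phi) z)%E.
  rewrite -H; last by move=> y _; exact: F0.
  by apply: eq_measure_integral => A _ _; exact: muE.
by rewrite fubini_tonelli1//=; exact: measurableT_comp.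
Qed.

Lemma measurable_cons_tuple (R : realType) n (x : R) :
  measurable_fun [set: n.-tuple R] (cons_tuple x : n.-tuple R -> _).
Proof.
by apply: (@measurable_cons _ _ _ _ (fun=> x) n id) => //; exact: measurable_id.
Qed.

(** This gives [iint] access to the general theory of integration (linearity, domination,
    almost-everywhere arguments). The measure starts as the Dirac mass at the empty tuple, and each
    further dimension takes the image under consing of its product with Lebesgue measure. *)
Lemma iint_measure (R : realType) n :
  exists mu : {sigma_finite_measure set (n.-tuple R) -> \bar R},
    forall F : n.-tuple R -> \bar R, measurable_fun [set: n.-tuple R] F ->
      (forall t, 0 <= F t)%E -> (\int[mu]_t F t = iint F)%E.
Proof.
elim: n => [|n [nu nuE]].
  exists (dirac ([tuple] : 0.-tuple R)) => F mF F0.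
  by rewrite integral_dirac// diracT mul1e.
pose phi (xt : R * n.-tuple R) : n.+1.-tuple R := cons_tuple xt.1 xt.2.
pose psi (t : n.+1.-tuple R) : R * n.-tuple R := (thead t, [tuple of behead t]).
have [|||mu muE] := @ex_pushforward_prod_measure _ _ _ (measurableTypeR R) _ _ R
  (@lebesgue_measure R) nu phi psi.
- exact: measurable_cons.
- apply/measurable_fun_pairP; split; first exact: measurable_tnth.
  exact: measurable_behead.
- by move=> [x t]; rewrite /psi /phi /=; congr pair; apply: val_inj.
exists mu => F mF F0; rewrite muE//.
apply: eq_integral => x _; apply: nuE => //.
by apply: (measurableT_comp mF); exact: measurable_cons_tuple.
Qed.

(** * Invariance of the integral under reflections *)

Lemma ge0_integral_reflect (R : realType) (c : R) (f : R -> \bar R) :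
  measurable_fun [set: R] f -> (forall x, 0 <= f x)%E ->
  (\int[@lebesgue_measure R]_x f (c - x)%R = \int[@lebesgue_measure R]_x f x)%E.
Proof.
move=> mf f0.
pose phi (x : measurableTypeR R) : measurableTypeR R := c - x.
have mphi : measurable_fun setT phi.
  by apply: measurable_funB => //; exact: measurable_id.
have := @ge0_integral_pushforward _ _ _ _ R phi mphi (@lebesgue_measure R)
  setT f measurableT mf.
rewrite preimage_setT => H.
transitivity (\int[@lebesgue_measure R]_x (f \o phi) x)%E => //.
rewrite -H; last by move=> y _; exact: f0.
(* Lebesgue measure is determined by its values on half-open intervals. The reflection pulls []a,
   b]] back to [[c - b, c - a[], which has the same length. *)
apply: eq_measure_integral => A mA _.
apply/esym/(@lebesgue_measure_unique _ (pushforward lebesgue_measure phi)) => //.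
move=> _ [[a b]] _ <-.
have phiab (x : R) : (a < c - x <= b) = (c - b <= x < c - a).
  by apply/idP/idP => /andP[? ?]; apply/andP; split; lra.
have phiE : phi @^-1` `]a, b] = `[c - b, c - a[%classic.
  by apply/funext => x; rewrite /= !in_itv /= phiab.
rewrite [RHS](_ : _ = lebesgue_measure (phi @^-1` `]a, b])) // phiE.
rewrite !lebesgue_measure_itv/= !lte_fin ltrD2l ltrN2.
by case: ifPn => // _; congr EFin; ring.
Qed.

Lemma tsub_cons (R : realType) n (x : n.+1.-tuple R) a (t : n.-tuple R) :
  tsub x (cons_tuple a t) =
  cons_tuple (thead x - a) (tsub [tuple of behead x] t).
Proof.
apply: eq_from_tnth => i; rewrite tnth_mktuple.
rewrite [in LHS](tuple_eta x).
by case: (unliftP ord0 i) => [j|] ->; rewrite ?tnth0// !tnthS tnth_mktuple.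
Qed.

Lemma measurable_tsub (R : realType) n (x : n.-tuple R) :
  measurable_fun [set: n.-tuple R] (tsub x).
Proof.
apply/measurable_fun_tnthP => i.
rewrite (_ : _ \o _ = fun t => tnth x i - tnth t i); last first.
  by apply/funext => t /=; rewrite tnth_mktuple.
by apply: measurable_funB => //; exact: measurable_tnth.
Qed.

Lemma measurable_tsubl (R : realType) n (x : n.-tuple R) :
  measurable_fun [set: n.-tuple R] (fun t => tsub t x).
Proof.
apply/measurable_fun_tnthP => i.
rewrite (_ : _ \o _ = fun t => tnth t i - tnth x i); last first.
  by apply/funext => t /=; rewrite tnth_mktuple.
by apply: measurable_funB => //; exact: measurable_tnth.
Qed.

Lemma iint_ge0 (R : realType) n (F : n.-tuple R -> \bar R) :
  (forall t, 0 <= F t)%E -> (0 <= iint F)%E.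
Proof.
elim: n F => [|n IH] F F0 /=; first exact: F0.
by apply: integral_ge0 => x _; exact: IH.
Qed.

(** One coordinate at a time: the induction hypothesis reflects the inner integral, and the
    one-dimensional case the outer one. *)
Lemma iint_reflect (R : realType) n (x : n.-tuple R) (F : n.-tuple R -> \bar R) :
  measurable_fun [set: n.-tuple R] F -> (forall t, 0 <= F t)%E ->
  iint (fun t => F (tsub x t)) = iint F.
Proof.
elim: n => [|n IH] in x F *; move=> mF F0; first by congr F; rewrite [LHS]tuple0.
have [mu muE] := iint_measure R n.
pose H (a : R) := iint (fun t => F (cons_tuple a t)).
have mFa a : measurable_fun [set: n.-tuple R] (fun t => F (cons_tuple a t)).
  by apply: (measurableT_comp mF); exact: measurable_cons_tuple.
(* The one-dimensional case requires the inner integral to be measurable in [a]; written with [mu],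
   it is a partial integral in the sense of Tonelli. *)
have mH : measurable_fun [set: R] H.
  rewrite (_ : H = fun a => (\int[mu]_t F (cons_tuple a t))%E); last first.
    by apply/funext => a; rewrite muE.
  apply: (@measurable_fun_fubini_tonelli_F _ _ R _ R mu
    (fun z : R * n.-tuple R => F (cons_tuple z.1 z.2))) => //.
  by apply: (measurableT_comp mF); exact: measurable_cons.
transitivity (\int[@lebesgue_measure R]_a H (thead x - a)%R)%E.
  apply: eq_integral => a _ /=; rewrite /H -(IH [tuple of behead x])//.
  by congr iint; apply/funext => t; rewrite tsub_cons.
by rewrite ge0_integral_reflect// => a; exact: iint_ge0.
Qed.

(** * The pairing [tdot] and null families of parallel hyperplanes *)

Lemma measurable_tdot (R : realType) n (w : n.-tuple R) :
  measurable_fun [set: n.-tuple R] (tdot w).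
Proof.
apply: measurable_sum => i; apply: measurable_funM => //.
exact: measurable_tnth.
Qed.

Lemma tdot_cons (R : realType) n (w : n.+1.-tuple R) a (t : n.-tuple R) :
  tdot w (cons_tuple a t) = thead w * a + tdot [tuple of behead w] t.
Proof.
rewrite /tdot big_ord_recl tnth0; congr (_ * _ + _).
by apply: eq_bigr => i _; rewrite tnthS [in LHS](tuple_eta w) tnthS.
Qed.

Lemma tdot_tsub (R : realType) n (w x t : n.-tuple R) :
  tdot w (tsub x t) = tdot w x - tdot w t.
Proof.
rewrite /tdot -sumrB; apply: eq_bigr => i _.
by rewrite tnth_mktuple mulrBr.
Qed.

Lemma tsubK (R : realType) n (x t : n.-tuple R) : tsub x (tsub x t) = t.
Proof. by apply: eq_from_tnth => i; rewrite !tnth_mktuple subKr. Qed.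

Lemma measurable_countable (R : realType) (D : set R) :
  countable D -> measurable D.
Proof. by move=> cD; apply: countable_measurable => // x; exact: measurable_set1. Qed.

Lemma iint_cst0 (R : realType) n :
  iint (fun _ : n.-tuple R => 0%E) = 0%E.
Proof. by elim: n => [|n IH] //=; under eq_integral do rewrite IH; rewrite integral0. Qed.

(** Countably many parallel hyperplanes form a null set. If [w] has a nonzero entry after the first,
    every slice at fixed first coordinate is of the same kind in lower dimension, with [D]
    translated. Otherwise only the first coordinate matters, and it is confined to a countable
    set. *)
Lemma iint_indic_tdot0 (R : realType) n (w : n.-tuple R) (D : set R) :
  countable D -> (exists i, tnth w i != 0) ->
  iint (fun t => (\1_D (tdot w t))%:E) = 0%E.
Proof.
elim: n w D => [|n IH] w D cD [i wi0]; first by case: i wi0 => [].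
rewrite /=.
have cD' a : countable [set s | D (thead w * a + s)].
  apply: (sub_countable _ cD); apply: (card_ge_preimage (f := +%R _)).
  by move=> s t _ _; exact: addrI.
have [[l wl]|w0] := pselect (exists l, tnth [tuple of behead w] l != 0).
  rewrite integral0_eq// => a _.
  rewrite -[RHS](IH [tuple of behead w] [set s | D (thead w * a + s)] (cD' a) (ex_intro _ l wl)).
  by congr iint; apply/funext => t; rewrite tdot_cons.
have w0i l : tnth [tuple of behead w] l = 0.
  by apply/eqP/negPn/negP => wj; apply: w0; exists l.
have hw0 : thead w != 0.
  move: wi0; rewrite [in X in X -> _](tuple_eta w).
  by case: (unliftP ord0 i) => [j|] ->; rewrite ?tnth0// tnthS w0i eqxx.
have tw0 t : tdot [tuple of behead w] t = 0.
  by rewrite /tdot big1// => j _; rewrite w0i mul0r.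
pose E := [set a | D (thead w * a)].
have cE : countable E.
  apply: (sub_countable _ cD); apply: (card_ge_preimage (f := *%R _)).
  by move=> s t _ _; exact: mulfI.
(* The value [k] is infinite as soon as [n] is positive; this is harmless, since it is integrated
   over the null set [E] only. *)
pose k := iint (fun _ : n.-tuple R => 1%E).
transitivity (\int[@lebesgue_measure R]_(a in [set: R]) (((fun=> k) \_ E) a))%E.
  apply: eq_integral => a _; rewrite patchE /k; case: ifPn => aE.
    congr iint; apply/funext => t; rewrite tdot_cons tw0 addr0 indicE mem_set//.
    by move: aE; rewrite inE.
  rewrite -[RHS](iint_cst0 R n); congr iint; apply/funext => t.
  rewrite tdot_cons tw0 addr0 indicE memNset// => DE.
  by move/negP: aE; apply; rewrite inE.
rewrite -integral_mkcond null_set_integral//.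
- exact: measurable_countable.
- exact: countable_lebesgue_measure0.
Qed.

(** * Square-integrable functions and the signed integral *)

Section iint_integral.
Context (R : realType) (n : nat)
  (mu : {sigma_finite_measure set (n.-tuple R) -> \bar R})
  (muE : forall F : n.-tuple R -> \bar R, measurable_fun [set: n.-tuple R] F ->
      (forall t, 0 <= F t)%E -> (\int[mu]_t F t = iint F)%E).
Implicit Types f g h F G : n.-tuple R -> R.

Lemma iint_sq f : measurable_fun [set: n.-tuple R] f ->
  iint (fun t => (f t ^+ 2)%:E) = (\int[mu]_t (f t ^+ 2)%:E)%E.
Proof.
move=> mf; rewrite muE// => [|t]; last by rewrite lee_fin sqr_ge0.
by apply/measurable_EFinP; exact: measurable_funX.
Qed.

(** Translates [L2eq] and nullity of the window into almost-everywhere statements, which combine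
    well with products and with exceptional sets. *)
Lemma iint_sq_eq0 f : measurable_fun [set: n.-tuple R] f ->
  iint (fun t => (f t ^+ 2)%:E) = 0%E <-> {ae mu, forall t, f t = 0}.
Proof.
move=> mf; rewrite iint_sq//.
have mf2 : measurable_fun [set: n.-tuple R] (fun t => (f t ^+ 2)%:E).
  by apply/measurable_EFinP; exact: measurable_funX.
have := @ae_eq_integral_abs _ _ _ mu setT measurableT _ mf2.
rewrite (_ : (\int[mu]_t `|(f t ^+ 2)%:E| = \int[mu]_t (f t ^+ 2)%:E)%E); last first.
  by apply: eq_integral => t _; rewrite gee0_abs// lee_fin sqr_ge0.
move=> ->; split; apply: filterS => t /=.
  by move=> /(_ I) [] /eqP; rewrite sqrf_eq0 => /eqP.
by move=> -> _; rewrite expr0n.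
Qed.

(** Both sides are differences of integrals of the positive and negative parts, to each of which
    [muE] applies. *)
Lemma rint_Rintegral F : measurable_fun [set: n.-tuple R] F ->
  rint F = Rintegral mu setT F.
Proof.
move=> mF; rewrite /rint /Rintegral integralE -!muE.
- congr (fine (_ - _))%E; apply: eq_integral => t _.
    by rewrite funeposE EFin_max.
  by rewrite funenegE EFin_max.
- by apply/measurable_EFinP; apply: measurable_maxr => //; exact: measurable_funN.
- by move=> t; rewrite lee_fin le_max lexx orbT.
- by apply/measurable_EFinP; exact: measurable_maxr.
- by move=> t; rewrite lee_fin le_max lexx orbT.
Qed.

Lemma rint_linear (a b : R) F G :
  mu.-integrable setT (EFin \o F) -> mu.-integrable setT (EFin \o G) ->
  rint (fun t => a * F t + b * G t) = a * rint F + b * rint G.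
Proof.
move=> iF iG.
have mF : measurable_fun [set: n.-tuple R] F.
  by apply/measurable_EFinP; exact: measurable_int iF.
have mG : measurable_fun [set: n.-tuple R] G.
  by apply/measurable_EFinP; exact: measurable_int iG.
rewrite !rint_Rintegral//; last first.
  by apply: measurable_funD; apply: measurable_funM.
rewrite (@RintegralD _ _ _ mu setT (fun t => a * F t) (fun t => b * G t))//.
- by rewrite !RintegralZl.
- rewrite (_ : _ \o _ = fun t => (a%:E * (F t)%:E)%E)//; exact: integrableZl.
- rewrite (_ : _ \o _ = fun t => (b%:E * (G t)%:E)%E)//; exact: integrableZl.
Qed.

Lemma rint_ae0 F : measurable_fun [set: n.-tuple R] F ->
  {ae mu, forall t, F t = 0} -> rint F = 0.
Proof.
move=> mF F0; rewrite rint_Rintegral// /Rintegral.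
rewrite (@ae_eq_integral _ _ _ mu setT (cst 0%E))//.
- by rewrite integral0.
- exact/measurable_EFinP.
- by move: F0; apply: filterS => t /= ->.
Qed.

Lemma L2R_integrable_sq f : L2R f ->
  mu.-integrable setT (fun t => (f t ^+ 2)%:E).
Proof.
move=> [mf f2]; apply/integrableP; split.
  by apply/measurable_EFinP; exact: measurable_funX.
rewrite (_ : (\int[mu]_t `|(f t ^+ 2)%:E| = \int[mu]_t (f t ^+ 2)%:E)%E).
  by rewrite -iint_sq.
by apply: eq_integral => t _; rewrite gee0_abs// lee_fin sqr_ge0.
Qed.

Lemma L2R_integrableM f g h : L2R f -> L2R g ->
  measurable_fun [set: n.-tuple R] h -> (forall t, `|h t| <= 1) ->
  mu.-integrable setT (EFin \o (fun t => f t * g t * h t)).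
Proof.
move=> f2 g2 mh h1.
have mf := f2.1; have mg := g2.1.
(* The dominating function comes from [2 |f| |g| <= f ^+ 2 + g ^+ 2], that is, from the square of
   [|f| - |g|] being nonnegative. *)
apply: (@le_integrable _ _ _ mu setT measurableT _
  (fun t => (f t ^+ 2)%:E + (g t ^+ 2)%:E)%E).
- by apply/measurable_EFinP; do 2! apply: measurable_funM => //.
- move=> t _ /=; rewrite lee_fin normrM.
  rewrite (le_trans (ler_wpM2l (normr_ge0 _) (h1 t)))// mulr1.
  rewrite [leRHS]ger0_norm ?addr_ge0 ?sqr_ge0// normrM.
  rewrite -(real_normK (num_real (f t))) -(real_normK (num_real (g t))).
  have := sqr_ge0 (`|f t| - `|g t|).
  have := mulr_ge0 (normr_ge0 (f t)) (normr_ge0 (g t)); nra.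
- by apply: integrableD => //; exact: L2R_integrable_sq.
Qed.

End iint_integral.

Lemma L2R_reflect (R : realType) n (x : n.-tuple R) (f : n.-tuple R -> R) :
  L2R f -> L2R (fun t => f (tsub x t)).
Proof.
move=> [mf f2]; split.
  by apply: (measurableT_comp mf); exact: measurable_tsub.
rewrite (iint_reflect x (F := fun t => (f t ^+ 2)%:E))// => [|t].
  by apply/measurable_EFinP; exact: measurable_funX.
by rewrite lee_fin sqr_ge0.
Qed.

(** A translation is a composition of two reflections, so the invariance proved for reflections
    carries over to translations. *)
Lemma tsub_reflect (R : realType) n (x t : n.-tuple R) :
  tsub t x = tsub [tuple 0 | i < n] (tsub x t).
Proof. by apply: eq_from_tnth => i; rewrite !tnth_mktuple sub0r opprB. Qed.

Lemma L2R_translate (R : realType) n (x : n.-tuple R) (f : n.-tuple R -> R) :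
  L2R f -> L2R (fun t => f (tsub t x)).
Proof.
move=> f2; under eq_fun do rewrite tsub_reflect.
exact: (L2R_reflect x (L2R_reflect _ f2)).
Qed.

Lemma L2RM_bounded (R : realType) n (M : R) (f q : n.-tuple R -> R) : L2R f ->
  measurable_fun [set: n.-tuple R] q -> (forall t, `|q t| <= M) ->
  L2R (fun t => f t * q t).
Proof.
move=> f2 mq qM; have mf := f2.1.
have mfq : measurable_fun [set: n.-tuple R] (fun t => f t * q t).
  exact: measurable_funM.
split=> //; have [mu muE] := iint_measure R n; rewrite (iint_sq muE)//.
(* The square of the product is dominated by [M ^+ 2 * f ^+ 2]. *)
have If := integrableZl measurableT (M ^+ 2) (L2R_integrable_sq muE f2).
have /integrableP[_] := If; apply: le_lt_trans.
apply: ge0_le_integral => //.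
- by move=> t _; rewrite lee_fin sqr_ge0.
- by apply/measurable_EFinP; exact: measurable_funX.
- by apply: measurableT_comp => //; exact: measurable_int If.
- move=> t _; have M0 : 0 <= M by rewrite (le_trans _ (qM t)).
  rewrite -EFinM abse_EFin lee_fin ger0_norm; last first.
    by rewrite mulr_ge0 ?sqr_ge0.
  rewrite exprMn mulrC ler_wpM2r ?sqr_ge0// -(real_normK (num_real (q t))).
  by rewrite lerXn2r ?nnegrE.
Qed.

Lemma rint_reflect (R : realType) n (x : n.-tuple R) (F : n.-tuple R -> R) :
  measurable_fun [set: n.-tuple R] F -> rint (fun t => F (tsub x t)) = rint F.
Proof.
move=> mF; rewrite /rint; congr (fine (_ - _))%E.
- rewrite (iint_reflect x (F := fun t => (Num.max (F t) 0)%:E))// => [|t].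
    by apply/measurable_EFinP; exact: measurable_maxr.
  by rewrite lee_fin le_max lexx orbT.
- rewrite (iint_reflect x (F := fun t => (Num.max (- F t) 0)%:E))// => [|t].
    by apply/measurable_EFinP; apply: measurable_maxr => //; exact: measurable_funN.
  by rewrite lee_fin le_max lexx orbT.
Qed.

(** * Modulus of the short-time Fourier transform *)

Lemma measurable_trig_tdot (R : realType) n (h : R -> R) (w : n.-tuple R) :
  continuous h ->
  measurable_fun [set: n.-tuple R] (fun t => h (2 * pi * tdot w t)).
Proof.
move=> ch; apply: (measurableT_comp (continuous_measurable_fun ch)).
by apply: measurable_funM => //; exact: measurable_tdot.
Qed.

Lemma norm_cos_le1 (R : realType) (x : R) : `|cos x| <= 1.
Proof. by rewrite ler_norml cos_geN1 cos_le1. Qed.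

Lemma norm_sin_le1 (R : realType) (x : R) : `|sin x| <= 1.
Proof. by rewrite ler_norml sin_geN1 sin_le1. Qed.

(* Reflecting [t -> x - t] conjugates the Fourier transform up to a unimodular
   factor. *)
Lemma STFT_abs_reflect (R : realType) n (g f1 f2 : n.-tuple R -> R)
    (x w : n.-tuple R) : L2R g -> L2R f1 -> L2R f2 ->
    (forall t, f1 (tsub x t) * g (tsub (tsub x t) x) = f2 t * g (tsub t x)) ->
  STFT_abs g f1 x w = STFT_abs g f2 x w.
Proof.
move=> g2 f12 f22 f1f2.
have [mu muE] := iint_measure R n.
have gx2 := L2R_translate x g2.
pose th (t : n.-tuple R) := 2 * pi * tdot w t.
have thB t : th (tsub x t) = th x - th t by rewrite /th tdot_tsub mulrBr.
have mcos := measurable_trig_tdot w (@continuous_cos R).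
have msin := measurable_trig_tdot w (@continuous_sin R).
have iC := L2R_integrableM muE f22 gx2 mcos (fun t => norm_cos_le1 _).
have iS := L2R_integrableM muE f22 gx2 msin (fun t => norm_sin_le1 _).
have mf1g : measurable_fun [set: n.-tuple R] (fun t => f1 t * g (tsub t x)).
  by apply: measurable_funM; [case: f12|case: gx2].
pose C := rint (fun t => f2 t * g (tsub t x) * cos (th t)).
pose S := rint (fun t => f2 t * g (tsub t x) * sin (th t)).
(* The substitution turns the phase [th t] into [th x - th t]. By the subtraction formulas, the real
   and imaginary parts for [f1] are the image of [(C, S)] under a rotation by an angle depending on
   [th x] only, while those for [f2] are [(C, - S)]: the sums of squares agree. *)
have reE : STFT_re g f1 x w = cos (th x) * C + sin (th x) * S.
  rewrite -(rint_linear muE _ _ iC iS) /STFT_re -(rint_reflect x); last first.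
    exact: measurable_funM.
  congr rint; apply/funext => t.
  by rewrite -/(th _) f1f2 thB cosB -/(th t); ring.
have imE : STFT_im g f1 x w = - (sin (th x) * C + - cos (th x) * S).
  rewrite -(rint_linear muE _ _ iC iS) /STFT_im -(rint_reflect x); last first.
    exact: measurable_funM.
  congr (- rint _); apply/funext => t.
  by rewrite -/(th _) f1f2 thB sinB -/(th t); ring.
rewrite /STFT_abs reE imE -[STFT_re _ _ _ _]/C -[STFT_im _ _ _ _]/(- S).
congr Num.sqrt; have := cos2Dsin2 (th x).
set c := cos _; set s := sin _ => cs.
rewrite (_ : _ + _ = (c ^+ 2 + s ^+ 2) * (C ^+ 2 + S ^+ 2)); last by ring.
by rewrite cs; ring.
Qed.

(** A null window vanishes almost everywhere, as do its translates, so both integrands are zero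
    almost everywhere. *)
Lemma STFT_abs_null (R : realType) n (g f : n.-tuple R -> R) (x w : n.-tuple R) :
  measurable_fun [set: n.-tuple R] g -> measurable_fun [set: n.-tuple R] f ->
  iint (fun t => (g t ^+ 2)%:E) = 0%E -> STFT_abs g f x w = 0.
Proof.
move=> mg mf g0; have [mu muE] := iint_measure R n.
have mgx : measurable_fun [set: n.-tuple R] (fun t => g (tsub t x)).
  by apply: (measurableT_comp mg); exact: measurable_tsubl.
have gx0 : {ae mu, forall t, g (tsub t x) = 0}.
  apply/(iint_sq_eq0 muE mgx).
  (* The translate of [g] is reached by the reflections through [t -> - t] and [t -> x - t], each of
     which preserves [iint]. *)
  rewrite -[RHS]g0.
  have mg2 : measurable_fun [set: n.-tuple R] (fun t => (g t ^+ 2)%:E).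
    by apply/measurable_EFinP; exact: measurable_funX.
  rewrite -(iint_reflect [tuple 0 | i < n] mg2); last first.
    by move=> t; rewrite lee_fin sqr_ge0.
  rewrite -(iint_reflect x (F := fun t => (g (tsub _ t) ^+ 2)%:E)).
  - by congr iint; apply/funext => t; rewrite tsub_reflect.
  - by apply: (measurableT_comp mg2); exact: measurable_tsub.
  - by move=> t; rewrite lee_fin sqr_ge0.
have z h : continuous h -> rint (fun t => f t * g (tsub t x) * h (2 * pi * tdot w t)) = 0.
  move=> ch; apply: (rint_ae0 muE).
    by apply: measurable_funM; [exact: measurable_funM|exact: measurable_trig_tdot].
  by move: gx0; apply: filterS => t ->; rewrite mulr0 mul0r.
rewrite /STFT_abs /STFT_re /STFT_im !z ?oppr0 ?expr0n ?addr0 ?sqrtr0//.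
- exact: continuous_sin.
- exact: continuous_cos.
Qed.

(** * Ingredients of the construction: sawtooth, unit cube, dual vector *)

Definition saw (R : realType) (s : R) : R := 1 + (s - (Num.floor s)%:~R).

Lemma saw_bounds (R : realType) (s : R) : 1 <= saw s <= 2.
Proof.
have /andP[] := floor_itv s; rewrite intrD /saw => h1 h2.
by apply/andP; split; lra.
Qed.

Lemma sawDz (R : realType) (k : int) (s : R) : saw (k%:~R + s) = saw s.
Proof.
by rewrite /saw floorDzr ?intr_int// intrKfloor intrD; ring.
Qed.

Lemma measurable_saw (R : realType) : measurable_fun [set: R] (@saw R).
Proof.
apply: measurable_funD => //; apply: measurable_funB; first exact: measurable_id.
by apply: nondecreasing_measurable => // x y xy; rewrite ler_int le_floor.
Qed.

(** Equal fractional parts of [s] and [- s] make [2 * s] the integer [floor s - floor (- s)]. The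
    exceptional values are thus half-integers, a countable set. *)
Lemma sawN_eq (R : realType) (s : R) : saw s = saw (- s) ->
  range (fun k : int => k%:~R / 2) s.
Proof.
rewrite /saw => h; exists (Num.floor s - Num.floor (- s)) => //=.
by rewrite intrB; lra.
Qed.

(** The function is the indicator of the unit cube, treated one coordinate at a time. It is used
    when the window is null and offers no signal of its own. *)
Lemma ex_L2R_neq0 (R : realType) n :
  exists2 f : n.-tuple R -> R, L2R f & iint (fun t => (f t ^+ 2)%:E) = 1%E.
Proof.
pose P (x : R) := x \in `[0, 1]%R.
pose f m (t : m.-tuple R) : R := (all P t)%:R.
have mf m : measurable_fun [set: m.-tuple R] (@f m).
  elim: m => [|m IH].
    rewrite (_ : @f 0%N = cst 1); first exact: measurable_cst.
    by apply/funext => t; rewrite /f (tuple0 t).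
  rewrite (_ : @f m.+1 =
      fun t => \1_(`[0, 1]%classic) (thead t) * f m [tuple of behead t]).
    apply: measurable_funM; last first.
      by apply: (measurableT_comp IH); exact: measurable_behead.
    have mI : measurable_fun [set: R] (\1_(`[0, 1]%classic) : R -> R).
      exact: measurable_indic.
    by apply: (measurableT_comp mI); exact: measurable_tnth.
  apply/funext => t; rewrite /f [in LHS](tuple_eta t) /= indicE mem_setE.
  by rewrite -mulnb natrM.
have If m : iint (fun t => (f m t ^+ 2)%:E) = 1%E.
  elim: m => [|m IH] /=; first by rewrite /f /= expr1n.
  transitivity (\int[@lebesgue_measure R]_x (\1_(`[0, 1]%classic) x)%:E)%E.
    apply: eq_integral => x _; rewrite indicE mem_setE -/(P x).
    case Px : (P x).
      by rewrite -[RHS]IH; congr iint; apply/funext => t; rewrite /f /= Px.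
    rewrite -[RHS](@iint_cst0 R m); congr iint; apply/funext => t.
    by rewrite /f /= Px expr0n.
  rewrite integral_indic//= setIT lebesgue_measure_itv/= lte_fin ltr01.
  by rewrite oppr0 adde0.
exists (f n) => //; split; first exact: mf.
by rewrite If ltry.
Qed.

(** Take the first row of [invmx A], which exists in positive dimension. Its pairing with the
    lattice point of coordinates [k] is the first entry of [k], and it is nonzero because it pairs
    to 1 with the first column of [A]. *)
Lemma lattice_dual (R : realType) n (A : 'M[R]_n) : (0 < n)%N -> A \in unitmx ->
  exists2 w : n.-tuple R, exists i, tnth w i != 0 &
    forall x, lattice A x -> exists k : int, tdot w x = k%:~R.
Proof.
case: n A => // n A _ uA; exists [tuple invmx A ord0 i | i < n.+1].
  apply: contrapT => w0.
  have := congr1 (fun B : 'M[R]_n.+1 => B ord0 ord0) (mulVmx uA).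
  rewrite !mxE eqxx big1 => [/esym/eqP|j _]; first by rewrite oner_eq0.
  apply/eqP; rewrite mulf_eq0; apply/orP; left; apply/negPn/negP => wj.
  by apply: w0; exists j; rewrite tnth_mktuple.
move=> x [k xk]; exists (k ord0).
rewrite /tdot; under eq_bigr do rewrite tnth_mktuple xk mulr_sumr.
rewrite exchange_big /=.
transitivity (\sum_j (invmx A *m A) ord0 j * (k j)%:~R).
  apply: eq_bigr => j _; rewrite mxE mulr_suml.
  by apply: eq_bigr => i _; rewrite mulrA.
rewrite mulVmx// (bigD1 ord0)//= big1 => [|j j0]; first by rewrite mxE eqxx mul1r addr0.
by rewrite mxE eq_sym (negbTE j0) mul0r.
Qed.

(** The factor [q] vanishes only on countably many hyperplanes orthogonal to [w], a null set, so it
    can be cancelled almost everywhere. *)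
Lemma iint_sqM_eq0 (R : realType) n (w : n.-tuple R) (D : set R)
    (f q : n.-tuple R -> R) :
    countable D -> (exists i, tnth w i != 0) ->
    measurable_fun [set: n.-tuple R] f -> measurable_fun [set: n.-tuple R] q ->
    (forall t, q t = 0 -> D (tdot w t)) ->
  iint (fun t => ((f t * q t) ^+ 2)%:E) = 0%E -> iint (fun t => (f t ^+ 2)%:E) = 0%E.
Proof.
move=> cD w0 mf mq qD; have [mu muE] := iint_measure R n.
have mfq : measurable_fun [set: n.-tuple R] (fun t => f t * q t).
  exact: measurable_funM.
have mI : measurable_fun [set: n.-tuple R] (fun t => \1_D (tdot w t) : R).
  have mID : measurable_fun [set: R] (\1_D : R -> R).
    by apply: measurable_indic; exact: measurable_countable.
  by apply: (measurableT_comp mID); exact: measurable_tdot.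
have /(iint_sq_eq0 muE mI) I0 : iint (fun t => ((\1_D (tdot w t) : R) ^+ 2)%:E) = 0%E.
  rewrite -[RHS](iint_indic_tdot0 cD w0); congr iint; apply/funext => t.
  by rewrite indicE; case: (_ \in _); rewrite ?expr1n ?expr0n.
move=> /(iint_sq_eq0 muE mfq) fq0; apply/(iint_sq_eq0 muE mf).
move: fq0 I0; apply: filterS2 => t /eqP; rewrite mulf_eq0 => /orP[/eqP//|/eqP/qD Dt].
by rewrite indicE mem_set// => /eqP; rewrite oner_eq0.
Qed.

(** * The two signals for a lattice of time shifts *)

Lemma STFT_abs_lattice (R : realType) n (g : n.-tuple R -> R) (A : 'M[R]_n) :
    (0 < n)%N -> L2R g -> A \in unitmx ->
  exists f1 f2 : n.-tuple R -> R,
    [/\ L2R f1, L2R f2,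
        (forall x w, lattice A x -> STFT_abs g f1 x w = STFT_abs g f2 x w),
        ~ L2eq f1 f2 & ~ L2eq f1 (fun t => - f2 t)].
Proof.
move=> n0 g2 uA; have mg := g2.1.
have [g0|g0] := pselect (iint (fun t => (g t ^+ 2)%:E) = 0%E).
  have [f f2 f1] := ex_L2R_neq0 R n; have mf := f2.1.
  have f_neq0 : ~ iint (fun t => (f t ^+ 2)%:E) = 0%E.
    by rewrite f1; apply/eqP; rewrite onee_neq0.
  (* For a null window all transforms are zero, so any non-null function can be paired with the zero
     function. *)
  exists f, (fun=> 0); split => //.
  - split; first exact: measurable_cst.
    by under eq_fun do rewrite expr0n/=; rewrite iint_cst0 ltry.
  - by move=> x w _; rewrite !STFT_abs_null.
  - by rewrite /L2eq; under eq_fun do rewrite subr0.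
  - by rewrite /L2eq; under eq_fun do rewrite oppr0 subr0.
have [w w0 wA] := lattice_dual n0 uA.
pose h (t : n.-tuple R) := g (tsub [tuple 0 | i < n] t).
have h2 : L2R h by exact: L2R_reflect.
have h0 : ~ iint (fun t => (h t ^+ 2)%:E) = 0%E.
  rewrite (iint_reflect _ (F := fun t => (g t ^+ 2)%:E))// => [|t].
    by apply/measurable_EFinP; exact: measurable_funX.
  by rewrite lee_fin sqr_ge0.
pose q1 (t : n.-tuple R) := saw (tdot w t).
pose q2 (t : n.-tuple R) := saw (- tdot w t).
have mq1 : measurable_fun [set: n.-tuple R] q1.
  by apply: (measurableT_comp (@measurable_saw R)); exact: measurable_tdot.
have mq2 : measurable_fun [set: n.-tuple R] q2.
  apply: (measurableT_comp (@measurable_saw R)).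
  by apply: measurable_funN; exact: measurable_tdot.
have saw_le2 (s : R) : `|saw s| <= 2.
  by have := saw_bounds s => /andP[? ?]; rewrite ger0_norm; lra.
pose D : set R := range (fun k : int => k%:~R / 2).
have cD : countable D by exact: (sub_countable (card_image_le _ _) (countableP _)).
have f1L2 := L2RM_bounded h2 mq1 (fun t => saw_le2 _).
have f2L2 := L2RM_bounded h2 mq2 (fun t => saw_le2 _).
exists (fun t => h t * q1 t), (fun t => h t * q2 t); split => //.
(* At [x - t] the weight [q1] equals [saw (k - w . t)], which is [q2 t] by periodicity. The other
   two factors trade places: [h (x - t)] is [g (t - x)], and [g ((x - t) - x)] is [h t]. *)
- move=> x om /wA[k xk]; apply: STFT_abs_reflect => // t.
  rewrite -/(h t) /q1 /q2 tdot_tsub xk sawDz.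
  rewrite (tsub_reflect x t) -/(h (tsub x t)).
  suff -> : tsub (tsub x t) x = tsub [tuple 0 | i < n] t by rewrite -/(h t); ring.
  by rewrite tsub_reflect tsubK.
(* The difference is [h * (q1 - q2)], whose second factor vanishes only where [w . t] is a
   half-integer. *)
- rewrite /L2eq; under eq_fun do rewrite -mulrBr.
  move=> /(iint_sqM_eq0 cD w0 h2.1) H; apply/h0/H.
    exact: measurable_funB.
  by move=> t /subr0_eq; exact: sawN_eq.
(* The sum is [h * (q1 + q2)], and [q1 + q2] is at least 2, so the condition on its zeros holds
   vacuously. *)
- rewrite /L2eq; under eq_fun do rewrite opprK -mulrDr.
  move=> /(iint_sqM_eq0 cD w0 h2.1) H; apply/h0/H.
    exact: measurable_funD.
  move=> t q0; have /andP[? _] := saw_bounds (tdot w t).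
  have /andP[? _] := saw_bounds (- tdot w t).
  by exfalso; move: q0; rewrite /q1 /q2; lra.
Qed.

Theorem theorem1p5 (R : realType) (d : nat) (hd : (0 < d)%N)
  (g : d.-tuple R -> R) (hg : L2R g)
  (L : set (d.-tuple R * d.-tuple R))
  (hL : (exists Lam : 'M[R]_d, Lam \in unitmx /\ L = lattice Lam `*` [set: d.-tuple R])
     \/ (exists A B : 'M[R]_d, A \in unitmx /\ B \in unitmx /\
           L = lattice A `*` lattice B)) :
  exists f1 f2 : d.-tuple R -> R,
    [/\ L2R f1, L2R f2,
        (forall z, L z -> STFT_abs g f1 z.1 z.2 = STFT_abs g f2 z.1 z.2),
        ~ L2eq f1 f2 & ~ L2eq f1 (fun t => - f2 t)].
Proof.
have [A uA LA] : exists2 A : 'M[R]_d, A \in unitmx & forall z, L z -> lattice A z.1.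
  by case: hL => [[A [uA ->]]|[A [B [uA [uB ->]]]]]; exists A => // z [].
have [f1 [f2 [f1L2 f2L2 eqf neqf neqNf]]] := STFT_abs_lattice hd hg uA.
by exists f1, f2; split => // z /LA; exact: eqf.
Qed.
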